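(* For all $x,y,z,w,a,b,c,d,A,B,C,D\in\mathbb{R}$, $$\Big(\langle x,y,z,w\rangle\langle a,b,c,d\rangle\Big)\langle A,B,C,D\rangle=\langle x,y,z,w\rangle\Big(\langle a,b,c,d\rangle\langle A,B,C,D\rangle\Big).$$
   Context: Elements $\langle x,y,z,w\rangle$ are identified with points $(x,y,z,w)$ of $\mathbb{R}^4$. Multiplication of such elements is defined, for all $x,y,z,w,a,b,c,d\in\mathbb{R}$, by $$\langle x,y,z,w\rangle\langle a,b,c,d\rangle=\langle P_1,P_2,P_3,P_4\rangle,$$ where $$P_1=\frac{(7x-y-z-w)(a+b+c+d)+(x+y+z+w)(7a-b-c-d)}{8},$$ $$P_2=\frac{(-x+7y-z-w)(a+b+c+d)+(x+y+z+w)(-a+7b-c-d)}{8},$$ $$P_3=\frac{(-x-y+7z-w)(a+b+c+d)+(x+y+z+w)(-a-b+7c-d)}{8},$$ $$P_4=\frac{(-x-y-z+7w)(a+b+c+d)+(x+y+z+w)(-a-b-c+7d)}{8}.$$ *)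

(* Defs.v *)
From Stdlib Require Import Reals.
Open Scope R_scope.

Definition R4 : Type := (R * R * R * R)%type.

Definition mul4 (p q : R4) : R4 :=
  let '(x, y, z, w) := p in
  let '(a, b, c, d) := q in
  ( ((7 * x - y - z - w) * (a + b + c + d)
     + (x + y + z + w) * (7 * a - b - c - d)) / 8,
    ((- x + 7 * y - z - w) * (a + b + c + d)
     + (x + y + z + w) * (- a + 7 * b - c - d)) / 8,
    ((- x - y + 7 * z - w) * (a + b + c + d)
     + (x + y + z + w) * (- a - b + 7 * c - d)) / 8,
    ((- x - y - z + 7 * w) * (a + b + c + d)
     + (x + y + z + w) * (- a - b - c + 7 * d)) / 8 ).

(* Main.v *)
(* Writing s and t for the coordinate sums of p and q, the i-th coordinate of
   the product is p_i t + s q_i - s t / 4, and so its coordinate sum is s t.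
   With u the coordinate sum of r, both triple products therefore have i-th
   coordinate p_i t u + s q_i u + s t r_i - s t u / 2. *)
Require Import Defs.
From Stdlib Require Import Reals.
Open Scope R_scope.

Theorem theorem3p1 (x y z w a b c d A B C D : R) :
  mul4 (mul4 (x, y, z, w) (a, b, c, d)) (A, B, C, D)
  = mul4 (x, y, z, w) (mul4 (a, b, c, d) (A, B, C, D)).
Proof.
  (* Quadruples are left-nested pairs, so splitting recurses through them and stops at four
     equations in [R], one per coordinate. Each is a polynomial identity once the denominators,
     powers of 8, are cleared; [field] itself discharges the condition that 8 is nonzero. *)
  unfold mul4; repeat apply (f_equal2 pair); field.
Qed.
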